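(* Let $(r_h^n,s_h^n)$, together with $p_h^{n+\frac12},q_h^{n+\frac12}$, be a solution in $V_h^k$, under periodic boundary conditions on $[L_f,L_r]$, of the symplectic local discontinuous Galerkin method defined in the context for the one-dimensional stochastic linear Schr\''odinger equation $i\,du-(u_{xx}+Q(x)u)\,dt=u\circ dW$, $u(x,0)=u_0(x)$, with numerical fluxes $\hat p=p_h^+$, $\hat r=r_h^-$, $\hat q=q_h^+$, $\hat s=s_h^-$, and put $u_h^n=r_h^n+is_h^n$. Then the numerical solution is $L^2$-stable: for all time levels $n$, $$\|u_h^n\|_{\mathbb L^2([L_f,L_r])}\le\|u_h^0\|_{\mathbb L^2([L_f,L_r])}.$$
   Context: Setting: $\mathcal O=[L_f,L_r]$ with periodic boundary conditions; $Q\in\mathbb H^3(\mathcal O)$ real-valued; $W(t,x)=\sum_k\beta_k(t)\,\phi e_k(x)$ is a real-valued Wiener process, with $(e_k)$ an orthonormal basis of $\mathbb L^2(\mathcal O)$, $(\beta_k)$ independent real Brownian motions and $\phi$ Hilbert--Schmidt from $\mathbb L^2$ to $\mathbb H^\gamma$ (the $L^2$-based Sobolev space of order $\gamma$); $\circ$ is the Stratonovich product. $\Delta t=T/N$, $t_n=n\Delta t$. Truncated increments: $\Delta\tilde W_n=\sum_k\sqrt{\Delta t}\,\zeta^\kappa_{k,n}\phi e_k(x)$, where $\xi_{k,n}=(\beta_k(t_{n+1})-\beta_k(t_n))/\sqrt{\Delta t}$, $\kappa=\sqrt{4|\ln(\Delta t)|}$, and $\zeta^\kappa_{k,n}$ equals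 $\kappa$ if $\xi_{k,n}>\kappa$, $\xi_{k,n}$ if $|\xi_{k,n}|\le\kappa$, $-\kappa$ if $\xi_{k,n}<-\kappa$. Mesh: $L_f=x_{\frac12}<x_{\frac32}<\dots<x_{J+\frac12}=L_r$, $I_j=[x_{j-\frac12},x_{j+\frac12}]$, $\Delta x_j=x_{j+\frac12}-x_{j-\frac12}$, $h=\max_j\Delta x_j$, and $\Delta x_j\ge ch$ for all $j$ with $c>0$ independent of $h$. $V_h^k$ is the space of real functions whose restriction to each $I_j$ is a polynomial of degree at most $k$. For a piecewise function $v$, $v^{+}_{j+\frac12}$ and $v^-_{j+\frac12}$ are the values at $x_{j+\frac12}$ from the right cell $I_{j+1}$ and the left cell $I_j$; by periodicity the points $x_{\frac12}$ and $x_{J+\frac12}$ are identified. Method: write $v^{n+\frac12}=\frac12(v^{n+1}+v^n)$ and $Q_h=Q$ for the potential in the discrete scheme. Find $r_h,p_h,s_h,q_h\in V_h^k$ such that for all $\nu_h,\omega_h,\alpha_h,\beta_h\in V_h^k$, all $1\le j\le J$ and all $n=0,1,\dots,N$: $$\int_{I_j}r_h^{n+1}\nu_h\,dx-\int_{I_j}r_h^n\nu_h\,dx-\Delta t\big[(\hat p^{n+\frac12}\nu_h^-)_{j+\frac12}-(\hat p^{n+\frac12}\nu_h^+)_{j-\frac12}\big]+\Delta t\int_{I_j}\big(p_h^{n+\frac12}(\nu_h)_x-s_h^{n+\frac12}Q_h\nu_h\big)dx-\int_{I_j}s_h^{n+\frac12}\nu_h\,\Delta\tilde W_n\,dx=0,$$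 $$\int_{I_j}p_h^{n+\frac12}\omega_h\,dx+\int_{I_j}s_h^{n+\frac12}(\omega_h)_x\,dx-\big[(\hat s^{n+\frac12}\omega_h^-)_{j+\frac12}-(\hat s^{n+\frac12}\omega_h^+)_{j-\frac12}\big]=0,$$ $$\int_{I_j}s_h^{n+1}\alpha_h\,dx-\int_{I_j}s_h^n\alpha_h\,dx+\Delta t\big[(\hat q^{n+\frac12}\alpha_h^-)_{j+\frac12}-(\hat q^{n+\frac12}\alpha_h^+)_{j-\frac12}\big]-\Delta t\int_{I_j}\big(q_h^{n+\frac12}(\alpha_h)_x-r_h^{n+\frac12}Q_h\alpha_h\big)dx+\int_{I_j}r_h^{n+\frac12}\alpha_h\,\Delta\tilde W_n\,dx=0,$$ $$\int_{I_j}q_h^{n+\frac12}\beta_h\,dx+\int_{I_j}r_h^{n+\frac12}(\beta_h)_x\,dx-\big[(\hat r^{n+\frac12}\beta_h^-)_{j+\frac12}-(\hat r^{n+\frac12}\beta_h^+)_{j-\frac12}\big]=0.$$ The inequality in the claim is understood almost surely. *)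

(* Defs.v *)
From HB Require Import structures.
From mathcomp Require Import all_boot all_order all_algebra.
From mathcomp Require Import complex.
From mathcomp Require Import all_classical all_reals all_analysis.
Set Implicit Arguments.
Unset Strict Implicit.
Unset Printing Implicit Defensive.
Import Order.TTheory GRing.Theory Num.Theory.
Import numFieldNormedType.Exports.
Local Open Scope classical_set_scope.
Local Open Scope ring_scope.

Section LebesgueSpace.
Context {R : realType}.
Implicit Types (a b : R) (f g : R -> R).

Definition leb_on a b : {measure set (measurableTypeR R) -> \bar R} :=
  mrestr lebesgue_measure (measurable_itv `[a, b]).

(* Elements of L^2([a, b]) are represented by measurable functions on R; two
   representatives are identified when they agree a.e. on [a, b]. *)
Definition inL2 a b f : Prop := f \in Lfun (leb_on a b) 2%:E.

Definition normL2 a b f : \bar R := 'N[leb_on a b]_2%:E[EFin \o f]%E.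

Definition normL2C a b (u : R -> R[i]) : \bar R :=
  'N[leb_on a b]_2%:E[(fun y => (Normc.normc (u y))%:E)]%E.

Definition dotL2 a b f g : R :=
  \int[lebesgue_measure]_(y in `[a, b]) (f y * g y).

Definition cvgL2 a b (F : nat -> R -> R) f : Prop :=
  normL2 a b (fun y => F n y - f y) @[n --> \oo] --> 0%E.

Definition orthonormal_basis a b (e : nat -> R -> R) : Prop :=
  [/\ forall k, inL2 a b (e k),
      forall i j, dotL2 a b (e i) (e j) = (i == j)%:R
    & forall f, inL2 a b f ->
        cvgL2 a b (fun n y => \sum_(k < n) dotL2 a b f (e k) * e k y) f].

End LebesgueSpace.

(* H^g(]a, b[) for real g >= 0: with m the integer part of g and s = g - m, the
   weak derivatives of order <= m are in L^2 and, if s > 0, the one of order m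
   has a finite Gagliardo (Sobolev-Slobodeckij) seminorm of order s.  No
   boundary condition is imposed, so the periodic Sobolev spaces are included. *)
Section Sobolev.
Context {R : realType}.
Implicit Types (a b g : R) (u : R -> R).

Definition test_function a b (f : R -> R) : Prop :=
  (forall n x, derivable (f^`(n))%classic x 1) /\
  exists c d, [/\ a < c, d < b & forall x, f x != 0 -> c <= x <= d].

Definition weak_derivative a b (m : nat) u v : Prop :=
  forall f, test_function a b f ->
    dotL2 a b u (f^`(m))%classic = (-1) ^+ m * dotL2 a b v f.

Definition gagliardo a b (s : R) v : \bar R :=
  (\int[lebesgue_measure]_(x in `[a, b]) \int[lebesgue_measure]_(y in `[a, b])
     ((v x - v y) ^+ 2 / `|x - y| `^ (1 + 2 * s))%:E)%E.

Definition sobolev_energy a b g (D : nat -> R -> R) : \bar R :=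
  let m := Num.truncn g in
  (\sum_(i < m.+1) normL2 a b (D i) ^+ 2 +
   if (m%:R < g)%R then gagliardo a b (g - m%:R) (D m) else 0)%E.

(* The weak derivatives being unique up to a.e. equality, the infimum below is
   over a set with at most one element; it is +oo when there is none. *)
Definition sobolev_sqnorm a b g u : \bar R :=
  ereal_inf [set sobolev_energy a b g D | D in [set D | forall i,
    (i <= Num.truncn g)%N ->
    inL2 a b (D i) /\ weak_derivative a b i u (D i)]].

Definition inSobolev a b g u : Prop :=
  inL2 a b u /\ (sobolev_sqnorm a b g u < +oo)%E.

Definition bounded_operator a b g (phi : (R -> R) -> R -> R) : Prop :=
  [/\ forall f, inL2 a b f -> inSobolev a b g (phi f),
      forall f f', inL2 a b f -> inL2 a b f' ->
        f = f' %[ae leb_on a b] -> phi f = phi f' %[ae leb_on a b],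
      forall (t : R) f f', inL2 a b f -> inL2 a b f' ->
        phi (fun y => t * f y + f' y) =
          (fun y => t * phi f y + phi f' y) %[ae leb_on a b]
    & exists C : R, forall f, inL2 a b f ->
        (sobolev_sqnorm a b g (phi f) <= C%:E * normL2 a b f ^+ 2)%E].

Definition hilbert_schmidt a b g (e : nat -> R -> R)
    (phi : (R -> R) -> R -> R) : Prop :=
  bounded_operator a b g phi /\
  (\sum_(0 <= k <oo) sobolev_sqnorm a b g (phi (e k)) < +oo)%E.

End Sobolev.

Section Brownian.
Context {R : realType} {d : measure_display} {Om : measurableType d}.
Variable P : probability Om R.

Definition mutual_independence (I : choiceType)
    (F : I -> set (set Om)) : Prop :=
  forall (s : seq I) (A : I -> set Om), uniq s ->
    (forall i, i \in s -> F i (A i)) ->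
    P (\bigcap_(i in [set` s]) A i) = (\prod_(i <- s) P (A i))%E.

Definition sigma_rv (X : Om -> R) : set (set Om) :=
  [set X @^-1` B | B in measurable].

Definition sigma_process (X : R -> Om -> R) : set (set Om) :=
  <<s \bigcup_(t in [set t | 0 <= t]) sigma_rv (X t) >>.

(* Only the values of X at times t >= 0 matter. *)
Definition brownian_motion (X : R -> Om -> R) : Prop :=
  [/\ forall t, 0 <= t -> measurable_fun setT (X t),
      {ae P, forall w, X 0 w = 0},
      forall (m : nat) (t : nat -> R), 0 <= t 0%N ->
        (forall i, (i < m)%N -> t i <= t i.+1) ->
        mutual_independence
          (fun i : 'I_m => sigma_rv (fun w => X (t i.+1) w - X (t i) w)),
      forall s t, 0 <= s -> s < t -> forall B : set R, measurable B ->
        P [set w | B (X t w - X s w)] = normal_prob 0 (Num.sqrt (t - s)) B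
    & {ae P, forall w, {within `[0, +oo[, continuous (fun t => X t w)}}].

Definition independent_brownian_motions (beta : nat -> R -> Om -> R) : Prop :=
  (forall k, brownian_motion (beta k)) /\
  mutual_independence (fun k => sigma_process (beta k)).

End Brownian.

Section TruncatedNoise.
Context {R : realType} {Om : Type}.

Definition truncation (kappa xi : R) : R :=
  if kappa < xi then kappa else if `|xi| <= kappa then xi else - kappa.

Definition kappa_of (dt : R) : R := Num.sqrt (4 * `|ln dt|).

Definition zeta (beta : nat -> R -> Om -> R) (dt : R) (k n : nat) (w : Om) : R :=
  truncation (kappa_of dt)
    ((beta k (n.+1%:R * dt) w - beta k (n%:R * dt) w) / Num.sqrt dt).

Definition noise_partial_sum (beta : nat -> R -> Om -> R)
    (phi : (R -> R) -> R -> R) (e : nat -> R -> R) (dt : R) (n : nat) (w : Om)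
    (K : nat) (y : R) : R :=
  \sum_(k < K) Num.sqrt dt * zeta beta dt k n w * phi (e k) y.

(* D is a representative of the sum of the series of truncated increments. *)
Definition is_truncated_increment (a b : R) (beta : nat -> R -> Om -> R)
    (phi : (R -> R) -> R -> R) (e : nat -> R -> R) (dt : R) (n : nat) (w : Om)
    (D : R -> R) : Prop :=
  inL2 a b D /\ cvgL2 a b (noise_partial_sum beta phi e dt n w) D.

End TruncatedNoise.

(* The cells are indexed by j : 'I_J, the cell j being [x j, x j.+1]. *)
Section LDG.
Context {R : realType}.

Definition mesh_size (J : nat) (x : nat -> R) : R :=
  \big[Num.max/0]_(j < J) (x j.+1 - x j).

Definition is_mesh (a b c : R) (J : nat) (x : nat -> R) : Prop :=
  [/\ (0 < J)%N, x 0%N = a, x J = b,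
      forall j, (j < J)%N -> x j < x j.+1
    & forall j, (j < J)%N -> c * mesh_size J x <= x j.+1 - x j].

Variables (J : nat) (x : nat -> R).

(* A piecewise polynomial has two values at each interface, hence it is the
   family of its restrictions to the closed cells. *)
Definition broken_poly : Type := 'I_J -> {poly R}.

Implicit Types v f g : broken_poly.

Definition inVh (k : nat) v : Prop := forall j, (size (v j) <= k.+1)%N.

(* The function on [x 0, x J[ given by v, right-continuous at the interfaces. *)
Definition broken_fun v (y : R) : R :=
  \sum_(j < J) if x j <= y < x j.+1 then (v j).[y] else 0.

(* Traces at the right end x j.+1 of the cell j.  By periodicity the left end
   of the cell j is the right end of the cell ord_pred j. *)
Definition trace_minus v (j : 'I_J) : R := (v j).[x j.+1].
Definition trace_plus v (j : 'I_J) : R := (v (ordS j)).[x (ordS j)].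

Definition bracket (fhat : 'I_J -> R) v (j : 'I_J) : R :=
  fhat j * trace_minus v j - fhat (ord_pred j) * trace_plus v (ord_pred j).

Definition cell_int (j : 'I_J) (F : R -> R) : R :=
  \int[lebesgue_measure]_(y in `[x j, x j.+1]) F y.

Definition midpoint (V : nat -> broken_poly) (n : nat) : broken_poly :=
  fun j => 2^-1 *: (V n.+1 j + V n j).

Section Scheme.
Variables (k N : nat) (dt : R) (Q : R -> R) (dW : nat -> R -> R).
Variables phat rhat qhat shat : broken_poly -> 'I_J -> R.
Variables r p s q : nat -> broken_poly.

Definition scheme_r (n : nat) (j : 'I_J) (nu : broken_poly) : Prop :=
  cell_int j (fun y => (r n.+1 j).[y] * (nu j).[y])
  - cell_int j (fun y => (r n j).[y] * (nu j).[y])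
  - dt * bracket (phat (midpoint p n)) nu j
  + dt * cell_int j (fun y => (midpoint p n j).[y] * ((nu j)^`()).[y]
                              - (midpoint s n j).[y] * Q y * (nu j).[y])
  - cell_int j (fun y => (midpoint s n j).[y] * (nu j).[y] * dW n y) = 0.

Definition scheme_p (n : nat) (j : 'I_J) (om : broken_poly) : Prop :=
  cell_int j (fun y => (midpoint p n j).[y] * (om j).[y])
  + cell_int j (fun y => (midpoint s n j).[y] * ((om j)^`()).[y])
  - bracket (shat (midpoint s n)) om j = 0.

Definition scheme_s (n : nat) (j : 'I_J) (al : broken_poly) : Prop :=
  cell_int j (fun y => (s n.+1 j).[y] * (al j).[y])
  - cell_int j (fun y => (s n j).[y] * (al j).[y])
  + dt * bracket (qhat (midpoint q n)) al j
  - dt * cell_int j (fun y => (midpoint q n j).[y] * ((al j)^`()).[y]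
                              - (midpoint r n j).[y] * Q y * (al j).[y])
  + cell_int j (fun y => (midpoint r n j).[y] * (al j).[y] * dW n y) = 0.

Definition scheme_q (n : nat) (j : 'I_J) (be : broken_poly) : Prop :=
  cell_int j (fun y => (midpoint q n j).[y] * (be j).[y])
  + cell_int j (fun y => (midpoint r n j).[y] * ((be j)^`()).[y])
  - bracket (rhat (midpoint r n)) be j = 0.

(* The step n relates the levels n and n.+1, so the unknowns are defined at
   the levels 0, ..., N.+1. *)
Definition ldg_solution : Prop :=
  (forall n, (n <= N.+1)%N ->
     [/\ inVh k (r n), inVh k (p n), inVh k (s n) & inVh k (q n)]) /\
  (forall nu om al be : broken_poly,
     inVh k nu -> inVh k om -> inVh k al -> inVh k be ->
     forall (j : 'I_J) (n : nat), (n <= N)%N ->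
     [/\ scheme_r n j nu, scheme_p n j om, scheme_s n j al & scheme_q n j be]).

End Scheme.

Definition wave_fun (r s : broken_poly) (y : R) : R[i] :=
  Complex (broken_fun r y) (broken_fun s y).

End LDG.

(* Main.v *)
Require Import Defs.
From HB Require Import structures.
From mathcomp Require Import all_boot all_order all_algebra.
From mathcomp Require Import complex.
From mathcomp Require Import all_classical all_reals all_analysis.
From mathcomp Require Import measurable_realfun.
From mathcomp Require Import ring lra.
Import Order.TTheory GRing.Theory Num.Theory.
Import numFieldNormedType.Exports.
Local Open Scope classical_set_scope.
Local Open Scope ring_scope.

(** The scheme does not merely dissipate the [L^2] norm: on every sample path
    satisfying the discrete equations, it conserves the norm exactly.

    Test the four equations of one step with the midpoint values themselves:
    the [r]-equation with [r], the [s]-equation with [s], the [p]-equation with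
    [q] and the [q]-equation with [p].  In the sum of the first two, the
    potential and the noise both contribute [- s r + r s] and disappear; the
    time differences become half the increment of [r^2 + s^2], since
    [(f - g)(f + g)/2 = (f^2 - g^2)/2]; what is left is made of
    [p r_x - q s_x] and of boundary brackets.  The difference of the last two
    equations trades these for [- r p_x + s q_x], so that the volume integrals
    combine into those of [(p r)_x - (q s)_x], that is, into boundary values.
    As the fluxes are taken from opposite sides for the two members of each
    pair ([p] right and [r] left, [q] right and [s] left), all boundary values
    cancel, except for one interface quantity [p^+ r^- - q^+ s^-] at the two
    ends of the cell ([cell_energy_step]).  This quantity has the same value
    seen from both adjacent cells, hence it telescopes in the sum over the
    cells, and periodicity closes the sum ([sum_cyclic_diff]).  Therefore the
    integral of [r^2 + s^2] is constant in time ([energy_conservation]).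

    The potential must be integrable on the cells for the splitting of its
    integral to be legitimate; this holds as [Q] is square integrable on a
    bounded interval.  The two noise integrals stand alone and have the same
    integrand.  Finally the [L^2] norm of the piecewise polynomial wave
    function is the square root of the sum of the cell energies
    ([normL2C_wave_fun]). *)

(** * Lebesgue measure restricted to a segment *)

Section RestrictedLebesgue.
Context {R : realType}.
Implicit Types (a b : R) (A : set R).

Lemma integral_leb_on_sub a b A (f : R -> \bar R) : A `<=` `[a, b] ->
  (\int[leb_on a b]_(y in A) f y = \int[lebesgue_measure]_(y in A) f y)%E.
Proof.
move=> Aab; apply: eq_measure_integral => B _ BA.
by rewrite /leb_on /= /mrestr setIidl //; exact: subset_trans Aab.
Qed.

Lemma leb_on_setC a b : leb_on a b (~` `[a, b]) = 0%E.
Proof. by rewrite /leb_on /= /mrestr setICl measure0. Qed.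

Lemma leb_on_fin a b : leb_on a b setT \is a fin_num.
Proof.
rewrite /leb_on /= /mrestr setTI lebesgue_measure_itv /=.
by case: ifP => _ //.
Qed.

Lemma ge0_integral_leb_on a b (f : R -> \bar R) :
  measurable_fun setT f -> (forall y, 0 <= f y)%E ->
  (\int[leb_on a b]_y f y = \int[lebesgue_measure]_(y in `[a, b]) f y)%E.
Proof.
move=> mf f0.
rewrite (@ge0_negligible_integral _ _ _ (leb_on a b) setT (~` `[a, b])) //.
- by rewrite setTD setCK integral_leb_on_sub.
- exact: measurableC.
- exact: leb_on_setC.
Qed.

Lemma inL2_integrable a b (f : R -> R) : inL2 a b f ->
  lebesgue_measure.-integrable `[a, b] (EFin \o f).
Proof.
move=> f2.
have /Lfun1_integrable fi : f \in Lfun (leb_on a b) 1.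
  exact: Lfun_subset12 (leb_on_fin a b) _ f2.
have /integrableP[mf foo] :
    (leb_on a b).-integrable `[a, b] (EFin \o f).
  by apply: integrableS fi.
apply/integrableP; split => //.
by rewrite -(integral_leb_on_sub a b).
Qed.

End RestrictedLebesgue.

(** * Integrals of polynomials *)

Section PolynomialIntegral.
Context {R : realType}.
Implicit Types (a b : R) (f g : {poly R}) (Q : R -> R).

Definition poly_int a b f : R :=
  \int[lebesgue_measure]_(y in `[a, b]) f.[y].

Lemma integrable_horner a b f :
  lebesgue_measure.-integrable `[a, b] (EFin \o horner f).
Proof.
apply: continuous_compact_integrable; first exact: segment_compact.
by apply: continuous_subspaceT => y; exact: continuous_horner.
Qed.

Lemma poly_intD a b f g :
  poly_int a b (f + g) = poly_int a b f + poly_int a b g.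
Proof.
rewrite /poly_int -RintegralD //; try exact: integrable_horner.
by apply: eq_Rintegral => y _; rewrite hornerD.
Qed.

Lemma poly_intZ a b c f : poly_int a b (c *: f) = c * poly_int a b f.
Proof.
rewrite /poly_int -RintegralZl //; try exact: integrable_horner.
by apply: eq_Rintegral => y _; rewrite hornerZ.
Qed.

Lemma poly_intM a b f g :
  \int[lebesgue_measure]_(y in `[a, b]) (f.[y] * g.[y]) = poly_int a b (f * g).
Proof. by apply: eq_Rintegral => y _; rewrite hornerM. Qed.

Lemma poly_int_deriv a b f : a < b -> poly_int a b f^`() = f.[b] - f.[a].
Proof.
move=> ab; rewrite /poly_int /Rintegral (@continuous_FTC2 _ _ (horner f)) //.
- by apply: continuous_subspaceT => y; exact: continuous_horner.
- split.
  + by move=> y _; exact: derivable_horner.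
  + by apply: cvg_at_right_filter; exact: continuous_horner.
  + by apply: cvg_at_left_filter; exact: continuous_horner.
- by move=> y _; rewrite derivE.
Qed.

Lemma poly_int_parts a b f g : a < b ->
  poly_int a b (f * g^`()) + poly_int a b (g * f^`())
  = f.[b] * g.[b] - f.[a] * g.[a].
Proof.
move=> ab; rewrite -poly_intD -!hornerM -poly_int_deriv // derivM.
by congr poly_int; rewrite addrC mulrC.
Qed.

(** With [f] and [g] the values at the end and at the start of a time step,
    this is why the midpoint rule leads to an exact balance of the energy. *)
Lemma poly_int_midpoint a b f g :
  poly_int a b (f * (2^-1 *: (f + g))) - poly_int a b (g * (2^-1 *: (f + g)))
  = 2^-1 * (poly_int a b (f * f) - poly_int a b (g * g)).
Proof.
rewrite -!scalerAr !poly_intZ !mulrDr !poly_intD (mulrC g f); ring.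
Qed.

Lemma bounded_horner a b f :
  [bounded (horner f y : R^o) | y in `[a, b]].
Proof.
have cf : {within `[a, b], continuous (horner f : R -> R^o)}.
  by apply: continuous_subspaceT => y; exact: continuous_horner.
have /compact_bounded[M [Mr hM]] :=
  continuous_compact cf (@segment_compact _ a b).
by exists M; split => // C MC y aby; apply: (hM _ MC); exists y.
Qed.

Lemma integrable_poly_potential a b Q f g :
  lebesgue_measure.-integrable `[a, b] (EFin \o Q) ->
  lebesgue_measure.-integrable `[a, b]
    (EFin \o (fun y => f.[y] * Q y * g.[y])).
Proof.
move=> iQ.
have -> : EFin \o (fun y => f.[y] * Q y * g.[y]) =
    ((EFin \o horner (f * g)%R) \* (EFin \o Q))%E.
  by apply/funext => y /=; rewrite -EFinM hornerM mulrAC.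
apply: integrableMr => //; first exact: measurable_poly.
exact: bounded_horner.
Qed.

End PolynomialIntegral.

(** * Energy balance of one step *)

Section Energy.
Context {R : realType} {J : nat} (x : nat -> R).
Implicit Types (Q : R -> R) (dW : nat -> R -> R).
Implicit Types (u v f g : broken_poly (R := R) J).
Implicit Types (r p s q : nat -> broken_poly (R := R) J).

Definition cell_energy u v (j : 'I_J) : R :=
  poly_int (x j) (x j.+1) (u j * u j + v j * v j).

(** For [u = r], [f = p], [v = s] and [g = q], this is a discrete probability
    current: [p] and [q] approximate [s_x] and [r_x], and [r s_x - s r_x] is
    the imaginary part of [conj(w) w_x] for the wave function [w = r + i s]. *)
Definition flux u f v g (j : 'I_J) : R :=
  trace_plus x f j * trace_minus x u j - trace_plus x g j * trace_minus x v j.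

Lemma cell_intM (f g : {poly R}) (j : 'I_J) :
  cell_int x j (fun y => f.[y] * g.[y]) = poly_int (x j) (x j.+1) (f * g).
Proof. exact: poly_intM. Qed.

Lemma trace_plus_pred f j : trace_plus x f (ord_pred j) = (f j).[x j].
Proof. by rewrite /trace_plus ord_predK. Qed.

(** The only boundary terms that survive are products of two numerical fluxes,
    which do not depend on the cell from which the interface is seen. *)
Lemma cell_energy_step dt Q dW r p s q n (j : 'I_J) :
  x j < x j.+1 ->
  lebesgue_measure.-integrable `[x j, x j.+1] (EFin \o Q) ->
  scheme_r x dt Q dW (trace_plus x) r p s n j (midpoint r n) ->
  scheme_p x (trace_minus x) p s n j (midpoint q n) ->
  scheme_s x dt Q dW (trace_plus x) r s q n j (midpoint s n) ->
  scheme_q x (trace_minus x) r q n j (midpoint p n) ->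
  let F := flux (midpoint r n) (midpoint p n) (midpoint s n) (midpoint q n) in
  cell_energy (r n.+1) (s n.+1) j - cell_energy (r n) (s n) j
  = 2 * dt * (F j - F (ord_pred j)).
Proof.
move=> xj iQ; rewrite /scheme_r /scheme_p /scheme_s /scheme_q.
set rm := midpoint r n; set sm := midpoint s n.
set pm := midpoint p n; set qm := midpoint q n.
have potential u v f :
    cell_int x j (fun y => (u j).[y] * ((v j)^`()).[y]
                           - (f j).[y] * Q y * (v j).[y]) =
    poly_int (x j) (x j.+1) (u j * (v j)^`()) -
    cell_int x j (fun y => (f j).[y] * Q y * (v j).[y]).
  rewrite /cell_int RintegralB ?poly_intM //.
  - rewrite (_ : _ \o _ = EFin \o horner (u j * (v j)^`())).
      exact: integrable_horner.
    by apply/funext => y /=; rewrite hornerM.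
  - exact: integrable_poly_potential.
have swapQ : cell_int x j (fun y => (sm j).[y] * Q y * (rm j).[y]) =
    cell_int x j (fun y => (rm j).[y] * Q y * (sm j).[y]).
  by apply: eq_Rintegral => y _; rewrite mulrC mulrA mulrAC.
have swapW : cell_int x j (fun y => (sm j).[y] * (rm j).[y] * dW n y) =
    cell_int x j (fun y => (rm j).[y] * (sm j).[y] * dW n y).
  by apply: eq_Rintegral => y _; rewrite (mulrC (sm j).[y]).
rewrite !potential !cell_intM swapQ swapW.
have := poly_int_parts _ _ (pm j) (rm j) xj.
have := poly_int_parts _ _ (qm j) (sm j) xj.
have := poly_int_midpoint (x j) (x j.+1) (r n.+1 j) (r n j).
have := poly_int_midpoint (x j) (x j.+1) (s n.+1 j) (s n j).
rewrite -[2^-1 *: (r _ _ + _)]/(rm j) -[2^-1 *: (s _ _ + _)]/(sm j).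
rewrite /flux /cell_energy /bracket !trace_plus_pred !poly_intD.
rewrite [qm j * pm j]mulrC.
rewrite /trace_minus.
move=> Es Er Pq Pp Hr Hp Hs Hq.
(* The conclusion is a linear combination of the equations in which those
   without a time difference have coefficients proportional to [dt]. *)
have dPq := congr1 ( *%R dt) Pq; have dPp := congr1 ( *%R dt) Pp.
have dHp := congr1 ( *%R dt) Hp; have dHq := congr1 ( *%R dt) Hq.
lra.
Qed.

Lemma inVh_midpoint k r n :
  inVh k (r n) -> inVh k (r n.+1) -> inVh k (midpoint r n).
Proof.
move=> r0 r1 j; apply: leq_trans (size_scale_leq _ _) _.
by apply: leq_trans (size_polyD _ _) _; rewrite geq_max r1 r0.
Qed.

End Energy.

(** * Conservation of the total energy *)

Lemma sum_cyclic_diff (V : zmodType) (J : nat) (F : 'I_J -> V) :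
  \sum_j (F j - F (ord_pred j)) = 0.
Proof.
rewrite sumrB; apply/eqP; rewrite subr_eq0; apply/eqP.
exact: (reindex _ (onW_bij _ (ord_pred_bij J))).
Qed.

Lemma energy_conservation (R : realType) (J : nat) (x : nat -> R) (a b : R)
    (Q : R -> R) (dW : nat -> R -> R) dt k N
    (r p s q : nat -> broken_poly (R := R) J) :
  (forall j : 'I_J, x j < x j.+1) ->
  (forall j : 'I_J, `[x j, x j.+1] `<=` `[a, b]) ->
  lebesgue_measure.-integrable `[a, b] (EFin \o Q) ->
  ldg_solution x k N dt Q dW
    (trace_plus x) (trace_minus x) (trace_plus x) (trace_minus x) r p s q ->
  forall n, (n <= N.+1)%N ->
  \sum_j cell_energy x (r n) (s n) j = \sum_j cell_energy x (r 0%N) (s 0%N) j.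
Proof.
move=> xlt xsub iQ [Vh scheme]; elim=> [//|n IH] nN.
rewrite -IH; last exact: ltnW.
apply/eqP; rewrite -subr_eq0 -sumrB; apply/eqP.
have [r0 p0 s0 q0] := Vh n (ltnW nN); have [r1 p1 s1 q1] := Vh n.+1 nN.
(* The test functions of the [p]- and [q]-equations are exchanged. *)
have step j := scheme _ _ _ _ (inVh_midpoint _ _ _ r0 r1)
  (inVh_midpoint _ _ _ q0 q1) (inVh_midpoint _ _ _ s0 s1)
  (inVh_midpoint _ _ _ p0 p1) j n nN.
under eq_bigr => j _.
  have [Hr Hp Hs Hq] := step j.
  have iQj : lebesgue_measure.-integrable `[x j, x j.+1] (EFin \o Q).
    by apply: integrableS iQ.
  rewrite (cell_energy_step _ _ _ _ _ _ _ _ _ _ (xlt j) iQj Hr Hp Hs Hq).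
  over.
by rewrite -mulr_sumr sum_cyclic_diff mulr0.
Qed.

(** * The norm of a piecewise polynomial wave function *)

Section Norm.
Context {R : realType} {J : nat} (x : nat -> R).
Context (x_incr : forall j, (j < J)%N -> x j < x j.+1).
Implicit Types u v : broken_poly (R := R) J.

Lemma mesh_le i j : (i <= j)%N -> (j <= J)%N -> x i <= x j.
Proof.
elim: j => [|j IH]; first by rewrite leqn0 => /eqP ->.
rewrite leq_eqVlt => /predU1P[-> //|ij] jJ.
exact: le_trans (IH ij (ltnW jJ)) (ltW (x_incr _ jJ)).
Qed.

Lemma broken_fun_cell u (j : 'I_J) y :
  x j <= y < x j.+1 -> broken_fun x u y = (u j).[y].
Proof.
move=> /andP[jy yj]; rewrite /broken_fun (bigD1 j) //= jy yj big1 ?addr0 //.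
move=> i ij; case: ifP => // /andP[iy yi].
case: (ltngtP i j) => [lij|lji|/val_inj eij].
- have := le_lt_trans (le_trans (mesh_le _ _ lij (ltnW (ltn_ord j))) jy) yi.
  by rewrite ltxx.
- have := le_lt_trans (le_trans (mesh_le _ _ lji (ltnW (ltn_ord i))) iy) yj.
  by rewrite ltxx.
- by rewrite eij eqxx in ij.
Qed.

Lemma measurable_broken_fun u : measurable_fun setT (broken_fun x u).
Proof.
apply: measurable_sum => j; apply: measurable_fun_ifT => //.
- by apply: measurable_and; [exact: measurable_fun_ler|exact: measurable_fun_ltr].
- exact: measurable_poly.
Qed.

Lemma ge0_integral_mesh (f : R -> \bar R) :
  measurable_fun setT f -> (forall y, 0 <= f y)%E ->
  (\int[lebesgue_measure]_(y in `[x 0%N, x J]) f y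
   = \sum_(j < J) \int[lebesgue_measure]_(y in `[x j, x j.+1[) f y)%E.
Proof.
move=> mf f0.
rewrite -integral_itv_bndo_bndc; last exact: measurable_funTS.
rewrite -(big_mkord xpredT
  (fun j => \int[lebesgue_measure]_(y in `[x j, x j.+1[) f y)%E).
have : (J <= J)%N by [].
elim: {1 3 4}J => [|m IH] mJ.
  by rewrite big_geq // set_itvco0 integral_set0.
rewrite big_nat_recr //= -IH; last exact: ltnW.
rewrite -ge0_integral_setU //.
- by rewrite -itv_bndbnd_setU ?bnd_simp ?mesh_le // ltnW.
- exact: measurable_funTS.
- apply/disj_setPS => y [/=]; rewrite !in_itv /= => /andP[_ h1] /andP[h2 _].
  by have := lt_le_trans h1 h2; rewrite ltxx.
Qed.

Lemma integral_cell_energy u v (j : 'I_J) :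
  (\int[lebesgue_measure]_(y in `[x j, x j.+1[)
     (broken_fun x u y ^+ 2 + broken_fun x v y ^+ 2)%:E
   = (cell_energy x u v j)%:E)%E.
Proof.
transitivity (\int[lebesgue_measure]_(y in `[x j, x j.+1[)
     (EFin \o horner (u j * u j + v j * v j)) y)%E.
  apply: eq_integral => y; rewrite inE /= in_itv /= => yj.
  by rewrite !(broken_fun_cell _ _ _ yj) hornerD !hornerM !expr2.
rewrite integral_itv_bndo_bndc; last first.
  by apply/measurable_EFinP; exact: measurable_poly.
rewrite /cell_energy /poly_int /Rintegral fineK //.
by apply: integrable_fin_num => //; exact: integrable_horner.
Qed.

Lemma normL2C_wave_fun u v :
  normL2C (x 0%N) (x J) (wave_fun x u v)
  = ((\sum_j cell_energy x u v j)%:E `^ 2^-1)%E.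
Proof.
rewrite /normL2C unlock; congr (_ `^ _)%E.
pose f y := (broken_fun x u y ^+ 2 + broken_fun x v y ^+ 2)%:E.
have f0 y : (0 <= f y)%E by rewrite lee_fin addr_ge0 ?sqr_ge0.
have mf : measurable_fun setT f.
  by apply/measurable_EFinP; apply: measurable_funD; apply: measurable_funX;
     exact: measurable_broken_fun.
transitivity (\int[leb_on (x 0%N) (x J)]_y f y)%E.
  apply: eq_integral => y _ /=.
  rewrite /f ger0_norm ?sqrtr_ge0 // powR_mulrn ?sqrtr_ge0 // sqr_sqrtr //.
  by rewrite addr_ge0 ?sqr_ge0.
rewrite ge0_integral_leb_on // ge0_integral_mesh // -sumEFin.
by apply: eq_bigr => j _; exact: integral_cell_energy.
Qed.

End Norm.

(** * Stability in the [L^2] norm *)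

Theorem corollary2p1
  (R : realType) (d : measure_display) (Om : measurableType d)
  (P : probability Om R)
  (Lf Lr : R) (hL : Lf < Lr)
  (Q : R -> R) (hQ : inSobolev Lf Lr 3 Q)
  (beta : nat -> R -> Om -> R) (hbeta : independent_brownian_motions P beta)
  (e : nat -> R -> R) (he : orthonormal_basis Lf Lr e)
  (gamma : R) (hgamma : 0 <= gamma)
  (phi : (R -> R) -> R -> R) (hphi : hilbert_schmidt Lf Lr gamma e phi)
  (T : R) (hT : 0 < T) (N : nat) (hN : (0 < N)%N)
  (dt : R) (hdt : dt = T / N%:R)
  (dW : nat -> Om -> R -> R)
  (hdW : {ae P, forall w, forall n, (n <= N)%N ->
            is_truncated_increment Lf Lr beta phi e dt n w (dW n w)})
  (c : R) (hc : 0 < c) (J : nat) (x : nat -> R) (hx : is_mesh Lf Lr c J x)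
  (k : nat)
  (r p s q : nat -> Om -> broken_poly (R := R) J)
  (hsol : {ae P, forall w,
     ldg_solution x k N dt Q (fun n => dW n w)
       (trace_plus x) (trace_minus x) (trace_plus x) (trace_minus x)
       (fun n => r n w) (fun n => p n w) (fun n => s n w) (fun n => q n w)}) :
  {ae P, forall w, forall n, (n <= N.+1)%N ->
     (normL2C Lf Lr (wave_fun x (r n w) (s n w)) <=
      normL2C Lf Lr (wave_fun x (r 0%N w) (s 0%N w)))%E}.
Proof.
have [_ <- <- x_incr _] := hx.
have cell_sub (j : 'I_J) : `[x j, x j.+1] `<=` `[x 0%N, x J].
  move=> y /=; rewrite !in_itv /= => /andP[jy yj]; apply/andP; split.
  - by apply: le_trans jy; apply: mesh_le x_incr _ _ _ _ => //; exact: ltnW.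
  - by apply: le_trans yj _; apply: mesh_le x_incr _ _ _ _ => //.
have iQ : lebesgue_measure.-integrable `[x 0%N, x J] (EFin \o Q).
  by case: hx => _ -> -> _ _; apply: inL2_integrable; case: hQ.
apply: filterS hsol => w sol n nN.
rewrite !normL2C_wave_fun //.
have -> // := energy_conservation _ _ _ _ _ _ _ _ _ _ _ _ _ _ _ cell_sub iQ sol n nN.
by move=> j; exact: x_incr.
Qed.
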